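(* Let $A\subseteq B$ be an extension of commutative rings with unity and let $X$ be an indeterminate over $B$. Set $$\delta'_{(A,B)} := \sup\{\operatorname{ht}_{B[X]}(Q)\mid Q\in\operatorname{Spec}(B[X]),\ X\notin Q,\ (Q+XB[X])\cap A=\{0\}\}.$$ Then $$\max\{\dim(A)+1+\delta'_{(A,B)},\ \dim(B[X,X^{-1}])\}\le \dim(A+XB[X])\le \dim(A)+\dim(B[X]).$$
   Context: $A+XB[X]$ is the subring of $B[X]$ consisting of the polynomials with constant term in $A$. $\dim$ is Krull dimension and $\operatorname{ht}$ is the height of a prime ideal. By convention, $\delta'_{(A,B)}=-1$ if the set defining it is empty. *)

(* Defs.v *)
From HB Require Import structures.
From mathcomp Require Import all_boot all_order all_algebra.
From mathcomp Require Import generic_quotient ring_quotient.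
From mathcomp Require Import ring.
From mathcomp Require Import classical_sets constructive_ereal.

Set Implicit Arguments.
Unset Strict Implicit.
Unset Printing Implicit Defensive.

Import Order.TTheory GRing.Theory.

Local Open Scope classical_set_scope.
Local Open Scope ring_scope.

(* Rings are [comNzRingType]s, so 1 != 0; dimensions and heights live in
   [\bar int], where every set has a supremum. *)

Section Dimension.
Variable R : comNzRingType.

Definition spec_lt (P Q : prime_idealr R) : Prop :=
  {subset P <= Q} /\ ~ {subset Q <= P}.

(* P 0 < P 1 < ... < P n; the values of P beyond n are irrelevant. *)
Definition spec_chain (n : nat) (P : nat -> prime_idealr R) : Prop :=
  forall i : nat, (i < n)%N -> spec_lt (P i) (P i.+1).

Definition krull_dim : \bar int :=
  supremum -oo%E [set (n%:Z)%:E | n in [set n : nat |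
    exists P : nat -> prime_idealr R, spec_chain n P]].

Definition height (Q : prime_idealr R) : \bar int :=
  supremum -oo%E [set (n%:Z)%:E | n in [set n : nat |
    exists P : nat -> prime_idealr R, spec_chain n P /\ P n =i Q]].

End Dimension.

Section Subring.
Variables (R : comNzRingType) (S : subringClosed R).

Definition subring : Type := {x : R | x \in S}.

HB.instance Definition _ := SubChoice.on subring.
HB.instance Definition _ := [SubChoice_isSubComNzRing of subring by <:].

End Subring.

Section CompositePolynomials.
Variables (B : comNzRingType) (A : subringClosed B).

(* The polynomials with constant term in A, that is, A + X B[X]. *)
Definition polyAXB : {pred {poly B}} := [pred p : {poly B} | p`_0 \in A].

Fact polyAXB_subring_closed : subring_closed polyAXB.
Proof.
split=> [|p q|p q]; rewrite !inE.
- by rewrite coef1 rpred1.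
- by rewrite coefB; apply: rpredB.
- by rewrite coef0M; apply: rpredM.
Qed.

HB.instance Definition _ :=
  GRing.isSubringClosed.Build {poly B} polyAXB polyAXB_subring_closed.

Definition delta' : \bar int :=
  supremum (-1)%:E [set h | exists Q : prime_idealr {poly B},
    [/\ h = height Q, 'X \notin Q &
        [set q + 'X * g | q in [set` Q] & g in setT] `&` (polyC @` [set` A])
          = [set 0]]].

End CompositePolynomials.

(* B[X, X^-1] as the localization of B[X] at the powers of X: the pair (p, n)
   stands for p / X^n.  As X is not a zero divisor, p / X^m = q / X^n holds
   exactly when p X^n = q X^m. *)
Module Laurent.
Section Laurent.
Variable B : comNzRingType.

Definition frac : Type := ({poly B} * nat)%type.

HB.instance Definition _ := Choice.on frac.

Implicit Types u v w : frac.

Definition eqf u v : bool := u.1 * 'X^(v.2) == v.1 * 'X^(u.2).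

Fact mulXn_inj n : injective (fun p : {poly B} => p * 'X^n).
Proof. by move=> p q /= /(monic_rreg (monicXn B n)). Qed.

Fact eqf_refl : reflexive eqf.
Proof. by move=> u; rewrite /eqf. Qed.

Fact eqf_sym : symmetric eqf.
Proof. by move=> u v; rewrite /eqf eq_sym. Qed.

Fact eqf_trans : transitive eqf.
Proof.
move=> v u w /eqP uv /eqP vw; apply/eqP/(@mulXn_inj v.2).
by rewrite /= mulrAC uv mulrAC vw mulrAC.
Qed.

Canonical eqf_equiv := EquivRel eqf eqf_refl eqf_sym eqf_trans.

Definition type : Type := {eq_quot eqf}%qT.

HB.instance Definition _ : EqQuotient _ eqf type := EqQuotient.on type.
HB.instance Definition _ := Choice.on type.

Local Notation pi := (\pi_type)%qT.

Fact eqf_repr u : (repr (pi u)).1 * 'X^(u.2) = u.1 * 'X^((repr (pi u)).2).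
Proof. by apply/eqP; change (eqf (repr (pi u)) u); apply/eqmodP; rewrite reprK. Qed.

Definition zerof : frac := (0, 0%N).
Definition onef : frac := (1, 0%N).
Definition addf u v : frac := (u.1 * 'X^(v.2) + v.1 * 'X^(u.2), (u.2 + v.2)%N).
Definition oppf u : frac := (- u.1, u.2).
Definition mulf u v : frac := (u.1 * v.1, (u.2 + v.2)%N).

Definition zero : type := lift_cst type zerof.
Definition one : type := lift_cst type onef.
Definition add := lift_op2 type addf.
Definition opp := lift_op1 type oppf.
Definition mul := lift_op2 type mulf.

Canonical pi_zero_morph := PiConst zero.
Canonical pi_one_morph := PiConst one.

Fact pi_add : {morph pi : u v / addf u v >-> add u v}.
Proof.
move=> u v; unlock add; apply/eqmodP/eqP => /=; rewrite !exprD.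
have := eqf_repr u; have := eqf_repr v.
move: u v (repr (pi u)) (repr (pi v)) => [p m] [q n] [p' m'] [q' n'] /=.
move: ('X^m') ('X^n') ('X^m) ('X^n) => x' y' x y hv hu.
transitivity ((p * x') * (y * y') + (q * y') * (x * x')); first by ring.
by rewrite -hu -hv; ring.
Qed.
Canonical pi_add_morph := PiMorph2 pi_add.

Fact pi_opp : {morph pi : u / oppf u >-> opp u}.
Proof.
move=> u; unlock opp; apply/eqmodP/eqP => /=.
by rewrite !mulNr eqf_repr.
Qed.
Canonical pi_opp_morph := PiMorph1 pi_opp.

Fact pi_mul : {morph pi : u v / mulf u v >-> mul u v}.
Proof.
move=> u v; unlock mul; apply/eqmodP/eqP => /=.
by rewrite !exprD mulrACA -!eqf_repr mulrACA.
Qed.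
Canonical pi_mul_morph := PiMorph2 pi_mul.

Fact addA : associative add.
Proof.
elim/quotW=> -[p l]; elim/quotW=> -[q m]; elim/quotW=> -[r n].
rewrite !piE; apply/eqmodP/eqP; rewrite /= !exprD.
by move: ('X^l) ('X^m) ('X^n) => x y z; ring.
Qed.

Fact addC : commutative add.
Proof.
by elim/quotW=> u; elim/quotW=> v; rewrite !piE /addf addrC addnC.
Qed.

Fact add0 : left_id zero add.
Proof.
elim/quotW=> -[p n]; rewrite !piE; apply/eqmodP/eqP; rewrite /= !exprD.
by move: ('X^n) => x; rewrite !expr0; ring.
Qed.

Fact addN : left_inverse zero opp add.
Proof.
elim/quotW=> -[p n]; rewrite !piE; apply/eqmodP/eqP; rewrite /= !exprD.
by move: ('X^n) => x; rewrite !expr0; ring.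
Qed.

HB.instance Definition _ := GRing.isZmodule.Build type addA addC add0 addN.

Fact mulA : associative mul.
Proof.
by elim/quotW=> u; elim/quotW=> v; elim/quotW=> w;
  rewrite !piE /mulf /= mulrA addnA.
Qed.

Fact mulC : commutative mul.
Proof.
by elim/quotW=> u; elim/quotW=> v; rewrite !piE /mulf mulrC addnC.
Qed.

Fact mul1 : left_id one mul.
Proof. by elim/quotW=> -[p n]; rewrite !piE /mulf /= mul1r. Qed.

Fact mul_addl : left_distributive mul add.
Proof.
elim/quotW=> -[p l]; elim/quotW=> -[q m]; elim/quotW=> -[r n].
rewrite !piE; apply/eqmodP/eqP; rewrite /= !exprD.
by move: ('X^l) ('X^m) ('X^n) => x y z; ring.
Qed.

Fact one_neq0 : one != zero.
Proof.
rewrite !piE /= /eqf /=.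
by rewrite expr0 !mulr1 oner_eq0.
Qed.

HB.instance Definition _ :=
  GRing.Zmodule_isComNzRing.Build type mulA mulC mul1 mul_addl one_neq0.

End Laurent.
End Laurent.
HB.export Laurent.

Notation laurent := Laurent.type.

(* Main.v *)
(* Let R = A + X B[X].  A prime of R either contains X, hence all of X B[X], and
   is then the preimage of a prime of A under the constant term map, or it avoids
   X and is then the contraction of a unique prime of B[X] avoiding X.
   For the lower bounds, contract chains from B[X, X^-1], and stack the preimage
   of a chain of A on top of the contraction of a chain of B[X] ending at Q.
   For the upper bound, cut a chain of R at its first member P' containing X: the
   part from P' on is a chain of A.  The k members before P' extend to a chain of
   k primes Q_0 < ... < Q_(k-1) of B[X] avoiding X, and Q_(k-1) + X B[X] is
   proper because P' is, which gives one more prime and a chain of length k. *)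
Require Import Defs.
From HB Require Import structures.
From mathcomp Require Import all_boot all_order all_algebra.
From mathcomp Require Import generic_quotient ring_quotient.
From mathcomp Require Import boolp classical_sets constructive_ereal.
From mathcomp Require Import ring zify.

Set Implicit Arguments.
Unset Strict Implicit.
Unset Printing Implicit Defensive.

Import Order.TTheory GRing.Theory Num.Theory.

Local Open Scope classical_set_scope.
Local Open Scope ring_scope.

(** * Suprema of sets of extended integers *)

Lemma ereal_int_supremums_neq0 (S : set (\bar int)) :
  S !=set0 -> supremums S !=set0.
Proof.
move=> [s Ss].
have [[z Uz]|noU] := pselect (exists z : int, ubound S z%:E); last first.
  exists +oo%E; split=> [t _|[z| |] Uy //]; first exact: leey.
    by case: noU; exists z.
  case: noU; exists 0 => t /Uy; rewrite leeNy_eq => /eqP ->.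
  exact: leNye.
have [[r Sr]|noR] := pselect (exists r : int, S r%:E); last first.
  exists -oo%E; split=> [[r| |] St //|t _]; last exact: leNye.
    by case: noR; exists r.
  by have := Uz _ St; rewrite leye_eq.
have rz : r <= z by have := Uz _ Sr; rewrite lee_fin.
(* Every integer upper bound is at least [r], so the least one is [r + m] for the smallest possible
   natural [m]. *)
have Uex : exists m : nat, `[< ubound S (r + m%:Z)%:E >].
  exists `|z - r|%N; apply/asboolP.
  by rewrite gez0_abs ?subr_ge0// [r + _]addrC subrK.
case: (ex_minnP Uex) => m /asboolP Um m_min.
exists (r + m%:Z)%:E; split=> // -[y| |] Uy; last 2 first.
- exact: leey.
- by have := Uy _ Sr; rewrite leeNy_eq.
have ry : r <= y by have := Uy _ Sr; rewrite lee_fin.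
have yE : y = r + `|y - r|%N%:Z.
  by rewrite gez0_abs ?subr_ge0// [RHS]addrC subrK.
rewrite lee_fin [leRHS]yE lerD2l lez_nat; apply: m_min.
by apply/asboolP; rewrite -yE.
Qed.

Lemma ereal_int_le_supremum (x0 : \bar int) (S : set (\bar int)) t :
  S t -> (t <= supremum x0 S)%E.
Proof.
by move=> St; apply: ge_supremum_Nmem => //; apply: ereal_int_supremums_neq0; exists t.
Qed.

(** The hypothesis on [x0] covers empty [S], where [supremum] returns this default. *)
Lemma ereal_int_supremum_le (x0 e : \bar int) (S : set (\bar int)) :
  (x0 <= e)%E -> (forall t, S t -> (t <= e)%E) -> (supremum x0 S <= e)%E.
Proof.
move=> x0e Se; rewrite /supremum; case: eqP => [//|/eqP/set0P S0].
case: xgetP => [y _ [_ lb]|no].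
  by apply: lb => t; apply: Se.
by case: (ereal_int_supremums_neq0 S0) => y /no.
Qed.

(** * Primes as bare predicates, and chains of them *)

Section PrimePred.
Variable R : comNzRingType.
Implicit Types (I : {pred R}) (a u v : R).

Definition is_prime I : Prop := idealr_closed I /\ prime_idealr_closed I.

Lemma is_prime_prime_idealr (P : prime_idealr R) : is_prime P.
Proof.
split; last by move=> u v; rewrite prime_idealrM.
split; [exact: idealr0|by rewrite idealr1|].
by move=> a u v uP vP; rewrite rpredD// idealMr.
Qed.

Lemma is_prime_bundle I : is_prime I -> exists P : prime_idealr R, P =i I.
Proof.
case=> id_I prime_I.
pose hI := isIdealr.Build R I id_I.
pose hP := isPrimeIdealrClosed.Build R I prime_I.
pose P : prime_idealr R := HB.pack I hI hP.
by exists P.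
Qed.

Section Theory.
Variable I : {pred R}.
Hypothesis prime_I : is_prime I.

Lemma is_prime0 : 0 \in I. Proof. by case: prime_I => -[]. Qed.

Lemma is_prime1 : 1 \notin I. Proof. by case: prime_I => -[]. Qed.

Lemma is_primeD u v : u \in I -> v \in I -> u + v \in I.
Proof. by case: prime_I => -[_ _ cl] _ uI vI; rewrite -[u]mul1r cl. Qed.

Lemma is_primeMl a u : u \in I -> a * u \in I.
Proof.
by case: prime_I => -[I0 _ cl] _ uI; rewrite -[a * u]addr0 cl.
Qed.

Lemma is_primeM u v : (u * v \in I) = (u \in I) || (v \in I).
Proof.
apply/idP/orP => [/(proj2 prime_I)/orP //|[uI|vI]]; last exact: is_primeMl.
by rewrite mulrC is_primeMl.
Qed.

End Theory.

Lemma exists_prime I : idealr_closed I ->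
  exists2 M : {pred R}, is_prime M & {subset I <= M}.
Proof.
move=> [I0 I1 Icl].
(* The union of the empty chain must satisfy [ok], so containing [I] is required of nonempty [J]
   only. *)
pose ok (J : set R) := [/\ forall a u v, J u -> J v -> J (a * u + v),
  ~ J 1 & forall u, J u -> [set` I] `<=` J].
have [F Fok Ftot|M [[Mcl M1 MI] Mmax]] := @Zorn_bigcup R ok.
  split=> [a u v [X FX Xu] [Y FY Yv]|[X FX]|u [X FX Xu] t It].
  - have [XY|YX] := Ftot _ _ FX FY.
    + by exists Y => //; have [cl _ _] := Fok _ FY; apply: cl => //; apply: XY.
    + by exists X => //; have [cl _ _] := Fok _ FX; apply: cl => //; apply: YX.
  - by have [_ X1 _] := Fok _ FX; apply: X1.
  - by exists X => //; have [_ _ XI] := Fok _ FX; exact: (XI u).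
have IM : [set` I] `<=` M.
  have [M0|/set0P[u /MI//]] := eqVneq M set0.
  exfalso; apply: (Mmax [set` I]); rewrite ?M0.
    by split=> [//|/(_ 0)]; apply.
  split=> [a u v uI vI| |u _ //]; first exact: Icl.
  exact/negP.
exists (fun u => `[< M u >]); last by move=> u uI; apply/asboolP/IM.
have mulM a u : M u -> M (a * u).
  by move=> Mu; rewrite -[a * u]addr0; apply: Mcl => //; apply: IM.
split; first split.
- by apply/asboolP/IM.
- by apply/asboolP.
- move=> a u v /asboolP Mu /asboolP Mv; apply/asboolP; exact: Mcl.
move=> u v /asboolP Muv; apply/orP.
have [Mu|nMu] := pselect (M u); first by left; apply/asboolP.
right; apply/asboolP.
(* If [u] is outside [M], the ideal [M + (u)] is larger than the maximal [M], hence contains 1;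
   multiplying [1 = a * u + m] by [v] puts [v] in [M]. *)
pose J := [set a * u + m | a in [set: R] & m in M].
have MJ : M `<=` J by move=> m Mm; exists 0 => //; exists m; rewrite // mul0r add0r.
have Ju : J u by exists 1 => //; exists 0; [exact: IM|rewrite mul1r addr0].
have /contrapT : ~ ~ J 1.
  move=> J1; apply: (Mmax J); first by split=> // /(_ _ Ju).
  split=> // [a _ _ [b _ [m Mm <-]] [c _ [m' Mm' <-]]|_ _]; last first.
    exact: subset_trans IM MJ.
  exists (a * b + c) => //; exists (a * m + m'); first exact: Mcl.
  by ring.
move=> [a _ [m Mm a1]].
have -> : v = a * (u * v) + v * m by rewrite -[LHS]mul1r -a1; ring.
by apply: Mcl => //; apply: mulM.
Qed.

(** Strictness is given by a separating element, the datum to be carried from ring to ring. *)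
Definition prime_chain (n : nat) (I : nat -> {pred R}) : Prop :=
  (forall i, (i <= n)%N -> is_prime (I i)) /\
  (forall i, (i < n)%N ->
     {subset I i <= I i.+1} /\ exists2 u, u \in I i.+1 & u \notin I i).

Lemma prime_chain_sub n (I : nat -> {pred R}) i j : prime_chain n I ->
  (i <= j <= n)%N -> {subset I i <= I j}.
Proof.
move=> [_ lt_I] /andP[]; elim: j => [|j IHj]; first by rewrite leqn0 => /eqP -> _ u.
rewrite leq_eqVlt => /predU1P[-> _ u //|]; rewrite ltnS => ij jn u uI.
by apply: (lt_I j jn).1; apply: IHj => //; apply: ltnW.
Qed.

Lemma spec_chain_prime_chain n (P : nat -> prime_idealr R) :
  spec_chain n P -> prime_chain n P.
Proof.
move=> ltP; split=> [i _|i /ltP[sub nsub]]; first exact: is_prime_prime_idealr.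
split=> //; apply: contrapT => no; apply: nsub => u uP.
by apply: contrapT => nu; apply: no; exists u => //; apply/negP.
Qed.

Lemma prime_chain_le_krull_dim n (I : nat -> {pred R}) :
  prime_chain n I -> (n%:Z%:E <= krull_dim R)%E.
Proof.
move=> [prI ltI].
(* Members beyond [n] need not be prime, so the sequence is frozen at [n]. *)
have /choice[P PE] : forall i, exists P : prime_idealr R, P =i I (minn i n).
  by move=> i; apply: is_prime_bundle; apply: prI; apply: geq_minr.
apply: ereal_int_le_supremum; exists n => //; exists P => i lin.
have [sub [u uI nuI]] := ltI i lin.
have eqi : P i =i I i by move=> v; rewrite PE (minn_idPl (ltnW lin)).
have eqSi : P i.+1 =i I i.+1 by move=> v; rewrite PE (minn_idPl lin).
split=> [v|]; first by rewrite eqi eqSi; apply: sub.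
by move/(_ u); rewrite eqi eqSi => /(_ uI); apply/negP.
Qed.

Lemma krull_dim_le (e : \bar int) :
  (forall n (I : nat -> {pred R}), prime_chain n I -> (n%:Z%:E <= e)%E) ->
  (krull_dim R <= e)%E.
Proof.
move=> le_e; apply: ereal_int_supremum_le; first exact: leNye.
by move=> _ [n [P chP] <-]; apply: le_e (spec_chain_prime_chain chP).
Qed.

Lemma krull_dim_ge0 : (0 <= krull_dim R)%E.
Proof.
have [|M prM _] := @exists_prime (pred1 0).
  split; rewrite ?inE ?oner_eq0 // => a u v /eqP -> /eqP ->.
  by rewrite mulr0 addr0 inE.
by apply: (@prime_chain_le_krull_dim 0 (fun _ => M)); split.
Qed.

Lemma height_le (Q : prime_idealr R) (e : \bar int) :
  (forall n (I : nat -> {pred R}), prime_chain n I -> I n =i Q -> (n%:Z%:E <= e)%E) ->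
  (height Q <= e)%E.
Proof.
move=> le_e; apply: ereal_int_supremum_le; first exact: leNye.
move=> _ [n [P [chP PQ]] <-]; exact: le_e (spec_chain_prime_chain chP) PQ.
Qed.

(** The step from [I n] to [J 0] accounts for the extra 1 in the length. *)
Lemma prime_chain_cat n m (I J : nat -> {pred R}) :
  prime_chain n I -> prime_chain m J ->
  {subset I n <= J 0%N} -> (exists2 u, u \in J 0%N & u \notin I n) ->
  prime_chain (n + m).+1 (fun i => if (i <= n)%N then I i else J (i - n.+1)%N).
Proof.
move=> [prI ltI] [prJ ltJ] sub ex; split=> i i_le.
  by case: leqP => [/prI //|n_i]; apply: prJ; rewrite leq_subLR addSn.
case: (ltngtP i n) => [i_n|n_i|->].
- exact: ltI.
- by rewrite subSn//; apply: ltJ; rewrite ltn_subLR// addSn.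
- by rewrite subnn.
Qed.

End PrimePred.

(** * Contraction of chains along a ring morphism *)

Section Preimage.
Variables (R S : comNzRingType) (f : {rmorphism R -> S}).

Lemma is_prime_preim (I : {pred S}) :
  is_prime I -> is_prime [preim f of I].
Proof.
move=> prI; split; first split.
- by rewrite inE rmorph0 is_prime0.
- by rewrite inE rmorph1 is_prime1.
- by move=> a u v; rewrite !inE => uI vI; rewrite rmorphD rmorphM is_primeD ?is_primeMl.
- by move=> u v; rewrite !inE rmorphM is_primeM.
Qed.

(** Distinct primes may have the same contraction; a separating element in the image of [f] rules
    this out. *)
Lemma prime_chain_preim n (I : nat -> {pred S}) :
  prime_chain n I ->
  (forall i u, (i < n)%N -> u \in I i.+1 -> u \notin I i ->
     exists2 r, f r \in I i.+1 & f r \notin I i) ->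
  prime_chain n (fun i => [preim f of I i]).
Proof.
move=> [prI ltI] sep; split=> i i_n; first exact/is_prime_preim/prI.
have [sub [u uI nuI]] := ltI i i_n.
split=> [r|]; first by rewrite !inE; apply: sub.
by have [r rI nrI] := sep i u i_n uI nuI; exists r; rewrite inE.
Qed.

End Preimage.

(** * The localization map from B[X] to B[X, X^-1] *)

Section Laurent.
Variable B : comNzRingType.

Definition laurent_of_poly (p : {poly B}) : laurent B :=
  (\pi_(laurent B) (p, 0%N))%qT.

Lemma laurent_of_poly_zmod_morphism : zmod_morphism laurent_of_poly.
Proof.
move=> p q; rewrite -[- laurent_of_poly q]/(Laurent.opp _).
rewrite -Laurent.pi_opp -[RHS]/(Laurent.add _ _) -Laurent.pi_add.
by congr (\pi_(laurent B) _)%qT; rewrite /Laurent.addf /= !expr0 !mulr1.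
Qed.

Lemma laurent_of_poly_monoid_morphism : monoid_morphism laurent_of_poly.
Proof.
split=> [|p q].
  by rewrite -[RHS]/(Laurent.one B) /Laurent.one; unlock.
by rewrite -[RHS]/(Laurent.mul _ _) -Laurent.pi_mul.
Qed.

HB.instance Definition _ := GRing.isZmodMorphism.Build {poly B} (laurent B)
  laurent_of_poly laurent_of_poly_zmod_morphism.
HB.instance Definition _ := GRing.isMonoidMorphism.Build {poly B} (laurent B)
  laurent_of_poly laurent_of_poly_monoid_morphism.

(* X p generates the same ideal of B[X, X^-1] as p / X^n. *)
Lemma laurent_associate (u : laurent B) : exists p a b,
  laurent_of_poly ('X * p) = a * u /\ u = b * laurent_of_poly ('X * p).
Proof.
elim/quotW: u => -[p n]; exists p.
exists (\pi_(laurent B) ('X^(n.+1), 0%N))%qT.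
exists (\pi_(laurent B) (1, n.+1))%qT.
by split; rewrite -[RHS]/(Laurent.mul _ _) -Laurent.pi_mul;
  apply/eqmodP/eqP; rewrite /= !(exprD, exprS, expr0); ring.
Qed.

End Laurent.

(** * Primes of A + X B[X] *)

Section AXB.
Variables (B : comNzRingType) (A : subringClosed B).
Local Notation R := (subring (polyAXB A)).

Fact mulX_subproof (p : {poly B}) : 'X * p \in polyAXB A.
Proof. by rewrite inE coefXM rpred0. Qed.

Definition mulX (p : {poly B}) : R := Sub ('X * p) (mulX_subproof p).

Lemma mulXM p q : mulX p * mulX q = mulX 1 * mulX (p * q).
Proof. by apply: val_inj; rewrite /= mulr1; ring. Qed.

Lemma mulXE (r : R) : mulX (val r) = mulX 1 * r.
Proof. by apply: val_inj; rewrite /= mulr1. Qed.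

Lemma mulXD p q : mulX (p + q) = mulX p + mulX q.
Proof. by apply: val_inj; rewrite /= mulrDr. Qed.

(** As [p] may lie outside A + X B[X], X p need not be a multiple of X there, but its square X (X
    p^2) is. *)
Lemma is_prime_mulX (P : {pred R}) p :
  is_prime P -> mulX 1 \in P -> mulX p \in P.
Proof.
move=> prP XP; suff : mulX p * mulX p \in P by rewrite is_primeM// orbb.
by rewrite mulXM is_primeM// XP.
Qed.

Definition const_coef (r : R) : subring A := Sub (val r)`_0 (valP r).

Lemma const_coef_zmod_morphism : zmod_morphism const_coef.
Proof. by move=> r s; apply: val_inj; rewrite /= coefB. Qed.

Lemma const_coef_monoid_morphism : monoid_morphism const_coef.
Proof. by split=> [|r s]; apply: val_inj; rewrite /= ?coef1 ?coef0M. Qed.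

HB.instance Definition _ := GRing.isZmodMorphism.Build R (subring A)
  const_coef const_coef_zmod_morphism.
HB.instance Definition _ := GRing.isMonoidMorphism.Build R (subring A)
  const_coef const_coef_monoid_morphism.

Fact const_subproof (a : subring A) : (val a)%:P \in polyAXB A.
Proof. by rewrite inE coefC /= (valP a). Qed.

Definition const (a : subring A) : R := Sub (val a)%:P (const_subproof a).

Lemma const_zmod_morphism : zmod_morphism const.
Proof. by move=> a b; apply: val_inj; rewrite /= polyCB. Qed.

Lemma const_monoid_morphism : monoid_morphism const.
Proof. by split=> [|a b]; apply: val_inj; rewrite /= ?polyCM. Qed.

HB.instance Definition _ := GRing.isZmodMorphism.Build (subring A) R
  const const_zmod_morphism.
HB.instance Definition _ := GRing.isMonoidMorphism.Build (subring A) R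
  const const_monoid_morphism.

Lemma constK : cancel const const_coef.
Proof. by move=> a; apply: val_inj; rewrite /= coefC. Qed.

Lemma const_coef_decomp (r : R) : exists p, r = const (const_coef r) + mulX p.
Proof.
exists (\poly_(i < (size (val r)).-1) (val r)`_i.+1); apply: val_inj => /=.
apply/polyP=> -[|i]; rewrite coefD coefC coefXM ?addr0//= add0r coef_poly.
by case: ltnP => // le_i; rewrite nth_default//; case: size le_i.
Qed.

(* Contraction is injective on primes avoiding X, as X B[X] lies in A + X B[X]. *)
Lemma prime_chain_contract n (I : nat -> {pred {poly B}}) :
  prime_chain n I -> (forall i, (i <= n)%N -> 'X \notin I i) ->
  prime_chain n (fun i => [preim (val : R -> {poly B}) of I i]).
Proof.
move=> chI XI; apply: (prime_chain_preim chI) => i u i_n uI nuI.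
have [prI _] := chI.
exists (mulX u); rewrite /=; first by rewrite is_primeMl//; apply: prI.
by rewrite is_primeM ?negb_or ?nuI ?XI 1?ltnW//; apply/prI/ltnW.
Qed.

Lemma prime_chain_const_coef n (I : nat -> {pred subring A}) :
  prime_chain n I -> prime_chain n (fun i => [preim const_coef of I i]).
Proof.
move=> chI; apply: (prime_chain_preim chI) => i u i_n uI nuI.
by exists (const u); rewrite /= constK.
Qed.

(** Primes containing X contain X B[X], so a separating element can be replaced by its constant
    term. *)
Lemma prime_chain_const n (I : nat -> {pred R}) :
  prime_chain n I -> mulX 1 \in I 0%N ->
  prime_chain n (fun i => [preim const of I i]).
Proof.
move=> chI X0; apply: (prime_chain_preim chI) => i u i_n uI nuI.
have [prI _] := chI.
have [p uE] := const_coef_decomp u.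
have pI j : (j <= n)%N -> mulX p \in I j.
  move=> j_n; apply: is_prime_mulX; first exact: prI.
  exact: (prime_chain_sub chI) X0.
exists (const_coef u); rewrite /=.
  rewrite -[const _](addrK (mulX p)) -uE -mulN1r.
  by rewrite (is_primeD (prI _ i_n))// (is_primeMl (prI _ i_n))// pI.
apply: contra nuI => cI; rewrite uE (is_primeD (prI _ (ltnW i_n)))//.
exact/pI/ltnW.
Qed.

(* When [X] is not in [P], the prime of [B[X]] contracting to [P]. *)
Definition extension (P : {pred R}) : {pred {poly B}} := [pred p | mulX p \in P].

Lemma extension_val (P : {pred R}) r : is_prime P -> mulX 1 \notin P ->
  (val r \in extension P) = (r \in P).
Proof. by move=> prP /negPf XP; rewrite inE mulXE is_primeM// XP. Qed.

Lemma is_prime_extension (P : {pred R}) :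
  is_prime P -> mulX 1 \notin P -> is_prime (extension P).
Proof.
move=> prP XP.
(* This rests on (X p)(X q) = X (X p q) with X outside [P]; it gives primality and also absorption
   of multiples. *)
have mul p q : (p * q \in extension P) = (p \in extension P) || (q \in extension P).
  by rewrite !inE -is_primeM// mulXM is_primeM// (negPf XP).
split; last by move=> p q; rewrite mul.
split=> // [|a p q pP qP].
  by rewrite -[0]/(val (0 : R)) extension_val// is_prime0.
by rewrite inE mulXD is_primeD// -[_ \in P]/(a * p \in extension P) mul pP orbT.
Qed.

Lemma prime_chain_extension n (I : nat -> {pred R}) :
  prime_chain n I -> (forall i, (i <= n)%N -> mulX 1 \notin I i) ->
  prime_chain n (fun i => extension (I i)).
Proof.
move=> [prI ltI] XI; split=> i i_n; first by apply: is_prime_extension; auto.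
have [sub [u uI nuI]] := ltI i i_n.
split=> [p|]; first by rewrite !inE; apply: sub.
by exists (val u); rewrite extension_val//; [apply: prI|apply: XI|apply/prI/ltnW|apply/XI/ltnW].
Qed.

(* If 1 = q + X h with q in [extension P], then q lies in A + X B[X], hence in P,
   so that P' would contain both q and X h. *)
Lemma exists_prime_above_extension (P P' : {pred R}) :
  is_prime P -> mulX 1 \notin P ->
  is_prime P' -> mulX 1 \in P' -> {subset P <= P'} ->
  exists M, [/\ is_prime M, {subset extension P <= M} & 'X \in M].
Proof.
move=> prP XP prP' XP' sPP'.
have prL := is_prime_extension prP XP.
pose J : {pred {poly B}} :=
  fun p => `[< exists q h, q \in extension P /\ p = q + 'X * h >].
have [|M prM JM] := @exists_prime _ J.
  split.
  - by apply/asboolP; exists 0, 0; rewrite is_prime0// mulr0 addr0.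
  - apply/negP => /asboolP[q [h [qP oneE]]].
    have qE : q = val (1 - mulX h) by rewrite /= oneE addrK.
    have : 1 - mulX h \in P' by apply: sPP'; rewrite -extension_val// -qE.
    move=> /(is_primeD prP') /(_ (is_prime_mulX h prP' XP')).
    by rewrite subrK (negPf (is_prime1 prP')).
  - move=> a _ _ /asboolP[q [h [qP ->]]] /asboolP[q' [h' [qP' ->]]].
    apply/asboolP; exists (a * q + q'), (a * h + h').
    by split; [rewrite is_primeD// is_primeMl|ring].
exists M; split=> // [q qP|]; apply: JM; apply/asboolP.
  by exists q, 0; rewrite mulr0 addr0.
by exists 0, 1; rewrite is_prime0// mulr1 add0r.
Qed.

(** * The dimension inequalities *)

Lemma krull_dim_laurent_le : (krull_dim (laurent B) <= krull_dim R)%E.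
Proof.
apply: krull_dim_le => n I chI.
pose f : R -> laurent B := @laurent_of_poly B \o val.
apply: (@prime_chain_le_krull_dim _ _ (fun i => [preim f of I i])).
apply: (prime_chain_preim chI) => i u i_n uI nuI.
have [prI _] := chI.
have [p [a [b [pE uE]]]] := laurent_associate u.
exists (mulX p); rewrite /f /=; first by rewrite pE (is_primeMl (prI _ i_n)).
by apply: contra nuI => pI; rewrite uE (is_primeMl (prI _ (ltnW i_n))).
Qed.

Lemma krull_dim_subring_le : (krull_dim (subring A) <= krull_dim R)%E.
Proof.
apply: krull_dim_le => n I chI.
exact: prime_chain_le_krull_dim (prime_chain_const_coef chI).
Qed.

(* [I n] contracts into X B[X], the preimage of 0 under the constant term map,
   so it lies strictly below the preimage of [J 0]. *)
Lemma krull_dim_ge_add (Q : prime_idealr {poly B}) n m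
    (I : nat -> {pred {poly B}}) (J : nat -> {pred subring A}) :
  'X \notin Q ->
  [set q + 'X * g | q in [set` Q] & g in setT] `&` (polyC @` [set` A])
    = [set 0] ->
  prime_chain n I -> I n =i Q -> prime_chain m J ->
  ((n + m).+1%:Z%:E <= krull_dim R)%E.
Proof.
move=> XQ QA0 chI IQ chJ.
have XI i : (i <= n)%N -> 'X \notin I i.
  move=> i_n; apply: contra XQ => Xi; rewrite -IQ.
  by apply: (prime_chain_sub chI) Xi; rewrite i_n /=.
have [prJ _] := chJ.
have chI' := prime_chain_contract chI XI.
have chJ' := prime_chain_const_coef chJ.
apply: prime_chain_le_krull_dim (prime_chain_cat chI' chJ' _ _).
  move=> r; rewrite !inE IQ => rQ.
  suff -> : const_coef r = 0 by rewrite (is_prime0 (prJ _ _)).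
  have [p rE] := const_coef_decomp r.
  have : [set 0] (val (const (const_coef r))).
    rewrite -QA0; split.
      exists (val r) => //; exists (- p) => //.
      by rewrite {1}rE /= mulrN addrK.
    by exists (val (const_coef r)) => //; apply: valP.
  by move=> /= c0; apply: val_inj; apply: polyC_inj.
exists (mulX 1); rewrite !inE.
  suff -> : const_coef (mulX 1) = 0 by rewrite (is_prime0 (prJ _ _)).
  by apply: val_inj; rewrite /= mulr1 coefX.
by rewrite /= mulr1 XI.
Qed.

Lemma krull_dim_delta_le :
  (krull_dim (subring A) + 1 + delta' A <= krull_dim R)%E.
Proof.
have dA0 := krull_dim_ge0 (subring A).
have dAR := krull_dim_subring_le.
case dRE : (krull_dim R) => [d| |]; first last.
- by have := krull_dim_ge0 R; rewrite dRE.
- exact: leey.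
case dAE : (krull_dim (subring A)) dA0 dAR => [a| |] // _; last by rewrite dRE.
rewrite dRE lee_fin => a_d.
(* Both dimensions are now finite, so [delta'] can be isolated; its default -1 is covered by
   [a <= d]. *)
rewrite -leeBrDl//; apply: ereal_int_supremum_le.
  by rewrite -EFinD lee_fin; lia.
move=> _ [Q [-> XQ QA0]]; apply: height_le => n I chI IQ.
(* For a fixed chain [I], the inequality becomes a bound on dim A, to be checked on each chain [J]
   of A. *)
suff : (a%:E <= (d - 1 - n%:Z)%:E)%E by rewrite -EFinD !lee_fin; lia.
rewrite -dAE; apply: krull_dim_le => m J chJ.
have := krull_dim_ge_add XQ QA0 chI IQ chJ.
by rewrite dRE !lee_fin; lia.
Qed.

Lemma krull_dim_le_add :
  (krull_dim R <= krull_dim (subring A) + krull_dim {poly B})%E.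
Proof.
apply: krull_dim_le => n I chI.
have [prI _] := chI.
(* The least such [k] is the first index whose prime contains X, or [n.+1] if there is none. *)
have kex : exists k, (n < k)%N || (mulX 1 \in I k) by exists n.+1; rewrite ltnSn.
case: (ex_minnP kex) => k kP kmin.
have k_n : (k <= n.+1)%N by apply: kmin; rewrite ltnSn.
have XI i : (i < k)%N -> mulX 1 \notin I i.
  by move=> i_k; apply: contraL i_k => Xi; rewrite -leqNgt kmin// Xi orbT.
have [n_k|k_le] := ltnP n k.
  rewrite -[n%:Z%:E]add0e leeD ?krull_dim_ge0//.
  have chL : prime_chain n (fun i => extension (I i)).
    by apply: prime_chain_extension chI _ => i i_n; apply: XI; apply: leq_ltn_trans n_k.
  exact: prime_chain_le_krull_dim chL.
have Xk : mulX 1 \in I k by move: kP; rewrite ltnNge k_le.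
rewrite -(subnK k_le) PoszD EFinD; apply: leeD.
  have chk : prime_chain (n - k) (fun i => I (k + i)%N).
    have [_ ltI] := chI; split=> i i_le.
      by apply: prI; lia.
    by rewrite addnS; apply: ltI; lia.
  by apply: prime_chain_le_krull_dim (prime_chain_const chk _); rewrite addn0.
(* If the first prime already contains X, B[X] need only contribute 0. Otherwise [k] becomes [k.+1]:
   the extensions of [I 0] to [I k], topped by [M], form a chain of length [k.+1]. *)
case: k {kP kmin k_n} XI k_le Xk => [|k] XI k_le Xk; first exact: krull_dim_ge0.
have prk := prI _ (ltnW k_le).
have [M [prM sM XM]] := exists_prime_above_extension prk (XI k (ltnSn k))
  (prI _ k_le) Xk (chI.2 k k_le).1.
have chk : prime_chain k I.
  by split=> i i_k; [apply: prI|apply: chI.2]; lia.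
have chL := prime_chain_extension chk XI.
have chM : prime_chain 0 (fun _ => M) by split.
have := prime_chain_cat chL chM sM _; rewrite addn0 => ch.
apply: prime_chain_le_krull_dim (ch _); exists 'X => //.
(* X is outside the extension of [I k], since X * X in [I k] would force X into it. *)
by rewrite inE -['X]mulr1 -[mulX _]/(mulX (val (mulX 1))) mulXE is_primeM// orbb XI.
Qed.

End AXB.

Theorem corollary4p12 (B : comNzRingType) (A : subringClosed B) :
  (maxe (krull_dim (subring A) + 1 + delta' A) (krull_dim (laurent B))
     <= krull_dim (subring (polyAXB A)))%E /\
  (krull_dim (subring (polyAXB A))
     <= krull_dim (subring A) + krull_dim {poly B})%E.
Proof.
split; last exact: krull_dim_le_add.
by rewrite ge_max krull_dim_delta_le krull_dim_laurent_le.
Qed.
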